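(* Let $\dim V\ge 4$ and fix $J\in\mathcal{T}(V,g)$. Let $$\psi:E^{S}\to T\mathcal{T},\qquad \psi(A)=[FAF,\phi],$$ where a) $F=QS\in\Gamma(\mathfrak{gl}(\mathbb{V}))$ is such that $Q^{*}=Q$, $[Q,J]=0$, $[Q,\phi]=0$ and $S\in\{\mathbb{1},\,J+\phi,\,J-\phi,\,[J,\phi]\}$ (with $Q\in\Gamma(\mathfrak{gl}(\mathbb{V}))$); b) $E\in\{\mathfrak{o}(\mathbb{V},g),\ \mathfrak{o}_{\{\phi\}}(\mathbb{V}),\ \mathfrak{u}(\mathbb{V},J),\ \mathfrak{u}(\mathbb{V},\phi)\}$. Then, with both sides of each equation evaluated at every point $K\in\mathcal{T}(V,g)$: 1) For $E\in\{\mathfrak{o}(\mathbb{V},g),\mathfrak{o}_{\{\phi\}}(\mathbb{V})\}$, $$\mathrm{Im}\,\psi=\mathcal{D}^{QS}:=\{B\in\mathfrak{o}_{\{\phi\}} \ |\ B:\mathrm{Ker}QS\to 0,\ \mathrm{Im}QS\to\mathrm{Im}QS\}.$$ 2) For $E=\mathfrak{u}(\mathbb{V},J)$, $$\mathrm{Im}\,\psi=\mathcal{D}^{QS}_{\mathfrak{u}(J)}:=\{[B,\phi]\in\mathfrak{o}_{\{\phi\}} \ |\ B\in\mathfrak{u}(V,J),\ B:\mathrm{Ker}QS\to 0,\ \mathrm{Im}QS\to\mathrm{Im}QS\}.$$ 3) For $E=\mathfrak{u}(\mathbb{V},\phi)$, $\mathrm{Im}\,\psi=0$.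
   Context: $(V,g)$ is a $2n$-dimensional real vector space with a positive definite metric. $\mathcal{T}=\mathcal{T}(V,g)=\{K\in \mathrm{End}V : K^{2}=-1,\ g(K\cdot,K\cdot)=g(\cdot,\cdot)\}$, a submanifold of $\mathrm{End}V$. $\mathbb{V}=V\times\mathcal{T}$, $\mathfrak{gl}(\mathbb{V})=\mathrm{End}V\times\mathcal{T}$, $\mathfrak{o}(\mathbb{V},g)=\mathfrak{o}(V,g)\times\mathcal{T}$. $\phi$ is the section with $\phi|_K=K$; $J$ and $\mathbb{1}$ are regarded as constant sections. $A^{*}$ is the $g$-adjoint, $[A,B]=AB-BA$, $\{A,B\}=AB+BA$. Further bundles (conditions imposed pointwise on $\mathcal{T}$): $\mathfrak{u}(\mathbb{V},J)=\{A\in\mathfrak{o}(\mathbb{V},g):[A,J]=0\}$ (fiber $\mathfrak{u}(V,J)$), $\mathfrak{u}(\mathbb{V},\phi)=\{A\in\mathfrak{o}(\mathbb{V},g):[A,\phi]=0\}$, $\mathfrak{o}_{\{\phi\}}=\mathfrak{o}_{\{\phi\}}(\mathbb{V})=\{A\in\mathfrak{o}(\mathbb{V},g):\{A,\phi\}=0\}$; the last is identified with $T\mathcal{T}$. Definition of $E^{S}$: for $S\in\{\mathbb{1},J+\phi,J-\phi,[J,\phi]\}$ and $\gamma\in\{\pm J,\pm\phi\}$ there is a unique $\tilde\gamma\in\{\pm J,\pm\phi\}$ with $\gamma S=S\tilde\gamma$, and it is also the unique element of $\{\pm J,\pm\phi\}$ with $S\gamma=\tilde\gamma S$. If $E=\{A\in\mathfrak{o}(\mathbb{V},g):\gamma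 A=A\delta\}$ with $\gamma\in\{\pm J,\pm\phi\}$ and $\delta\in\{+\gamma,-\gamma\}$, then $E^{S}=\{B\in\mathfrak{o}(\mathbb{V},g):\tilde\gamma B=B\tilde\delta\}$, where $\gamma S=S\tilde\gamma$ and $S\delta=\tilde\delta S$. If $E=\mathfrak{o}(\mathbb{V},g)$ then $E^{S}=\mathfrak{o}(\mathbb{V},g)$. *)

(* Defs.v *)
From HB Require Import structures.
From mathcomp Require Import all_boot all_order all_algebra.
From mathcomp Require Import all_classical all_reals all_analysis.

Set Implicit Arguments.
Unset Strict Implicit.
Unset Printing Implicit Defensive.

Import Order.TTheory GRing.Theory Num.Theory.
Import numFieldNormedType.Exports VectorInternalTheory.

Local Open Scope classical_set_scope.
Local Open Scope ring_scope.

Section Smooth.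
Variable R : realType.

Definition iter_derive (m p : nat) (vs : seq 'rV[R]_m)
    (f : 'rV[R]_m -> 'rV[R]_p) : 'rV[R]_m -> 'rV[R]_p :=
  foldr (fun v h x => 'D_v h x) f vs.

(* C^oo on some neighbourhood of a: all iterated directional derivatives
   exist and are continuous there. *)
Definition smooth_near (m p : nat) (f : 'rV[R]_m -> 'rV[R]_p)
    (a : 'rV[R]_m) : Prop :=
  \forall x \near a, forall vs : seq 'rV[R]_m,
    {for x, continuous (iter_derive vs f)} /\
    (forall v, derivable (iter_derive vs f) x v).

(* Smoothness on a (not necessarily open) set A, as for a map defined on an
   embedded submanifold: near every point of A, f agrees on A with a map that
   is C^oo in the ambient space. *)
Definition smooth_on (m p : nat) (A : set 'rV[R]_m)
    (f : 'rV[R]_m -> 'rV[R]_p) : Prop :=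
  forall a, A a -> exists2 h : 'rV[R]_m -> 'rV[R]_p,
    smooth_near h a & \forall x \near a, A x -> h x = f x.

End Smooth.

Section Twistor.
Variables (R : realType) (V : vectType R) (g : {dot V for @idfun R}).

Implicit Types A B K L : 'End(V).

Definition commutator A B : 'End(V) := ((A \o B) - (B \o A))%VF.
Definition anticommutator A B : 'End(V) := ((A \o B) + (B \o A))%VF.

(* B is the g-adjoint of A. *)
Definition is_adjoint A B : Prop := forall u v, g (A u) v = g u (B v).

Definition orth_lie : set 'End(V) := [set A | is_adjoint A (- A)].

Definition twistor : set 'End(V) :=
  [set K | (K \o K)%VF = - \1%VF /\ forall u v, g (K u) (K v) = g u v].

(* Sections over the twistor space of the trivial bundle with fibre End V:
   functions of K, of which only the values at K in twistor matter.  The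
   tautological section phi is id and constant sections are cst. *)
Definition section : Type := 'End(V) -> 'End(V).

Definition phi : section := id.

(* Smoothness is read in the coordinates v2r of the vector space End V. *)
Definition smooth_section (Q : section) : Prop :=
  smooth_on [set v2r K | K in twistor] (fun x => v2r (Q (r2v x))).

(* Subbundles of o(V, g) x twistor, given by their defining equation:
   Intertwiner gamma delta is {A | gamma A = A delta}. *)
Variant subbundle :=
  | FullO
  | Intertwiner of section & section.

Definition fiber (E : subbundle) K : set 'End(V) :=
  match E with
  | FullO => orth_lie
  | Intertwiner gamma delta =>
      [set A | orth_lie A /\ (gamma K \o A = A \o delta K)%VF]
  end.

Definition o_anti : subbundle := Intertwiner phi (fun K => - phi K).
Definition u_of (gamma : section) : subbundle := Intertwiner gamma gamma.

Lemma fiber_o_anti K :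
  fiber o_anti K = [set A | orth_lie A /\ anticommutator A K = 0].
Proof.
rewrite /fiber /= /phi /anticommutator.
apply/seteqP; split=> A /= [oA e]; split=> //.
  by rewrite e comp_lfunNr addrN.
by apply/eqP; rewrite comp_lfunNr -addr_eq0 addrC e.
Qed.

Lemma fiber_u_of gamma K :
  fiber (u_of gamma) K = [set A | orth_lie A /\ commutator A (gamma K) = 0].
Proof.
apply/seteqP; split=> A /= [oA]; rewrite /commutator => e; split=> //.
  by rewrite e subrr.
by apply/eqP; rewrite eq_sym -subr_eq0 e.
Qed.

Section FixedJ.
Variable J : 'End(V).

(* {J, -J, phi, -phi} *)
Definition signed_units : set section :=
  [set cst J; (fun=> - J); phi; (fun K => - phi K)].

(* {1, J + phi, J - phi, [J, phi]} *)
Definition admissible_S : set section :=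
  [set cst \1%VF; (fun K => J + phi K); (fun K => J - phi K);
       (fun K => commutator J (phi K))].

(* The unique element of signed_units with gamma S = S (tilde_l S gamma), as
   sections.  Uniqueness holds on the whole twistor space when dim V >= 4 (it
   may fail at a single K, e.g. where S K = 0); the default phi of xget is then
   never used. *)
Definition tilde_l (S gamma : section) : section :=
  xget phi [set gamma' | signed_units gamma' /\
    forall K, twistor K -> (gamma K \o S K = S K \o gamma' K)%VF].

(* The unique element of signed_units with S delta = (tilde_r S delta) S. *)
Definition tilde_r (S delta : section) : section :=
  xget phi [set delta' | signed_units delta' /\
    forall K, twistor K -> (S K \o delta K = delta' K \o S K)%VF].

(* E^S *)
Definition twist (E : subbundle) (S : section) : subbundle :=
  match E with
  | FullO => FullO
  | Intertwiner gamma delta => Intertwiner (tilde_l S gamma) (tilde_r S delta)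
  end.

Definition psi (F : section) K A : 'End(V) :=
  commutator (F K \o A \o F K)%VF (phi K).

(* B maps Ker F to 0 and Im F to itself. *)
Definition ker_im_compat (F B : 'End(V)) : Prop :=
  (forall v, v \in lker F -> B v = 0) /\ (B @: limg F <= limg F)%VS.

Definition distrib (F : section) K : set 'End(V) :=
  [set B | fiber o_anti K B /\ ker_im_compat (F K) B].

Definition distrib_uJ (F : section) K : set 'End(V) :=
  [set C | fiber o_anti K C /\
    exists B, [/\ fiber (u_of (cst J)) K B, ker_im_compat (F K) B
                & C = commutator B (phi K)]].

End FixedJ.
End Twistor.

(* Main.v *)
Require Import Defs.
From HB Require Import structures.
From mathcomp Require Import all_boot all_order all_algebra.
From mathcomp Require Import all_classical all_reals all_analysis.
From mathcomp Require Import ring.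

(** Everything happens in a single fibre, at a fixed twistor [K], where
    [F = Q S].

    Since [Q] is self-adjoint and commutes with [J] and [K], hence with [S], and
    [S] is self-adjoint or skew, [F] is self-adjoint or skew. Its kernel and
    image are therefore orthogonal complements, and it has a group inverse [G],
    the inverse of [F] on its image extended by zero on its kernel, with the
    same symmetry as [F]. If [A] is skew then so is [F A F], and it kills [Ker F]
    and maps [Im F] to itself; conversely a skew [X] with these two properties
    is [F (G X G) F]. Multiplication by [S] carries a signed unit to another one
    (lemma [admissible_swap]), and [Q] commutes with signed units, so the
    defining equation of the fibre of [E^S] for [A] corresponds exactly to the
    defining equation of the fibre of [E] for [F A F]. This is
    [sandwich_image]: [A |-> F A F] maps the fibre of [E^S] onto the elements of
    the fibre of [E] that kill [Ker F] and preserve [Im F].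

    It remains to take commutators with [K]. For [E = u(J)] the result is the
    definition of [distrib_uJ], and for [E = u(phi)] it is zero. For the two
    other bundles, [K] preserves [Ker F] and [Im F], so the commutator of [X]
    with [K] inherits the two properties from [X] and anticommutes with [K]; and
    taking the commutator with [K] twice multiplies an endomorphism that
    anticommutes with [K] by [- 4], so that every element of [distrib] is
    reached, already from [o_anti]. This is [commutator_image]. *)

Set Implicit Arguments.
Unset Strict Implicit.
Unset Printing Implicit Defensive.

Import Order.TTheory GRing.Theory Num.Theory.
Import numFieldNormedType.Exports.

Local Open Scope classical_set_scope.
Local Open Scope ring_scope.

(** * Adjoints, twistors and invariant kernels and images *)

Section PointwiseTheory.
Variables (R : realType) (V : vectType R) (g : {dot V for @idfun R}).
Implicit Types (A B C F G J K X : 'End(V)) (u v w : V).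

Lemma dotC u v : g u v = g v u.
Proof. by rewrite (hermC g) expr0 mul1r. Qed.

Lemma dotDl u v w : g (u + v) w = g u w + g v w.
Proof. exact: linearDl. Qed.

Lemma dotDr u v w : g w (u + v) = g w u + g w v.
Proof. exact: linearD. Qed.

Lemma dotBl u v w : g (u - v) w = g u w - g v w.
Proof. exact: linearBl. Qed.

Lemma dotBr u v w : g w (u - v) = g w u - g w v.
Proof. exact: linearBr. Qed.

Lemma dotNl u v : g (- u) v = - g u v.
Proof. exact: linearNl. Qed.

Lemma dotNr u v : g u (- v) = - g u v.
Proof. exact: linearNr. Qed.

Lemma dotZr a u v : g u (a *: v) = a * g u v.
Proof. exact: linearZr_LR. Qed.

Lemma dot_eq0 u : g u u = 0 -> u = 0.
Proof.
move=> gu0; apply/eqP; apply: contraT => nz_u.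
by have := neq0_dnorm_gt0 (s := g) u nz_u; rewrite gu0 ltxx.
Qed.

Lemma dot_inj u v : (forall w, g u w = g v w) -> u = v.
Proof.
move=> e; apply/eqP; rewrite -subr_eq0; apply/eqP/dot_eq0.
by rewrite dotBl e subrr.
Qed.

Lemma comp_eqP A B C G : (A \o B = C \o G)%VF <-> forall u, A (B u) = C (G u).
Proof.
split=> [e u|e]; first by rewrite -!comp_lfunE e.
by apply/lfunP => u; rewrite !comp_lfunE.
Qed.

Lemma commutator_eq0P A B : commutator A B = 0 <-> forall u, A (B u) = B (A u).
Proof.
rewrite /commutator; split=> [/eqP|/comp_eqP ->]; last by rewrite subrr.
by rewrite subr_eq0 => /eqP/comp_eqP.
Qed.

Lemma orth_lieP A : orth_lie g A <-> forall u v, g (A u) v = - g u (A v).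
Proof. by split=> oA u v; rewrite oA opp_lfunE dotNr ?opprK. Qed.

Lemma orth_lie0 : orth_lie g 0.
Proof. by move=> u v; rewrite oppr0 !zero_lfunE linear0l linear0r. Qed.

Lemma twistorP K : twistor g K ->
  (forall u, K (K u) = - u) /\ (forall u v, g (K u) v = - g u (K v)).
Proof.
case=> KK gK; have KE u : K (K u) = - u.
  by rewrite -comp_lfunE KK opp_lfunE id_lfunE.
by split=> // u v; rewrite -[LHS]gK KE dotNl.
Qed.

Lemma twistor_orth_lie K : twistor g K -> orth_lie g K.
Proof. by move=> /twistorP[_ sK]; apply/orth_lieP. Qed.

Lemma ker_im_compatP F B : ker_im_compat F B <->
  (forall v, F v = 0 -> B v = 0) /\ (forall v, exists w, B (F v) = F w).
Proof.
split=> [[kB /subvP iB]|[kB iB]]; split.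
- by move=> v Fv0; apply: kB; rewrite memv_ker Fv0.
- move=> v; have /memv_imgP[w _ ->] : B (F v) \in limg F.
    by apply: iB; rewrite !memv_img ?memvf.
  by exists w.
- by move=> v; rewrite memv_ker => /eqP /kB.
- apply/subvP => x /memv_imgP[y /memv_imgP[z _ ->] ->].
  by have [w ->] := iB z; rewrite memv_img ?memvf.
Qed.

(** * The group inverse of an endomorphism *)

(** The inverse of [F] on [Im F], extended by zero on [Ker F]; both [F \o G] and
    [G \o F] are then the projection on [Im F] along [Ker F]. *)
Definition group_inverse F G := [/\ forall u, G (F u) = F (G u),
  forall u, F (G (F u)) = F u & forall u, G (F (G u)) = G u].

(** When [Ker (F \o F) = Ker F], [F] is injective on [Im F], so by dimension
    [F] maps [Im F] onto itself, and a right inverse [H] of [F \o F] on its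
    image satisfies [F (F (H (F u))) = F u]. *)
Lemma group_inverse_exists F :
  (forall u, F (F u) = 0 -> F u = 0) -> exists G, group_inverse F G.
Proof.
move=> F_reg; pose F2 := (F \o F)%VF; pose H := (F2^-1)%VF.
have F_inj u v : F (F u) = F (F v) -> F u = F v.
  move=> e; apply/eqP; rewrite -subr_eq0 -linearB; apply/eqP/F_reg.
  by rewrite !linearB /= e subrr.
have imF2 : limg F2 = limg F.
  rewrite limg_comp; apply/eqP; rewrite eqEdim limgS ?subvf //=.
  rewrite [leqRHS]limg_dim_eq //; apply/eqP; rewrite -subv0; apply/subvP => x.
  rewrite memv_cap memv_ker memv0 => /andP[/memv_imgP[y _ ->] /eqP].
  by move/F_reg ->.
have FFH u : F (F (H (F u))) = F u.
  by rewrite -[LHS]comp_lfunE limg_lfunVK // imF2 memv_img ?memvf.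
have FHF u : F (H (F (F u))) = F u by apply: F_inj; rewrite FFH.
(* P = F H F is the projection on Im F along Ker F; F H P inverts F on Im F. *)
exists (F \o H \o F \o H \o F)%VF; split=> u; rewrite !comp_lfunE.
- by rewrite FHF FFH.
- by rewrite FHF FFH.
- by rewrite FHF FFH.
Qed.

(** The two relations make [Ker F] and [Im F] invariant under [A] and [B], so
    [A] commutes with the projection [F \o G]. *)
Lemma group_inverse_proj_comm F G A B : group_inverse F G ->
  (A \o F = F \o B)%VF -> (F \o A = B \o F)%VF ->
  forall u, A (F (G u)) = F (G (A u)).
Proof.
move=> [GF FGF _] /comp_eqP AF /comp_eqP FA u.
transitivity (F (G (A (F (G u))))); first by rewrite AF FGF.
by rewrite -!GF !FA FGF.
Qed.

(** Intertwining relations pass from [F] to its group inverse with [A] and [B]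
    exchanged; on [Im F] this is the usual inversion of [F \o A = B \o F]. *)
Lemma group_inverse_intertwine F G A B : group_inverse F G ->
  (A \o F = F \o B)%VF -> (F \o A = B \o F)%VF -> (G \o A = B \o G)%VF.
Proof.
move=> GI AF FA; have PA := group_inverse_proj_comm GI AF FA.
have PB := group_inverse_proj_comm GI (esym FA) (esym AF).
case: GI => GF FGF GFG; move/comp_eqP: AF => AF; apply/comp_eqP => u.
by rewrite -[LHS]GFG -PA AF GF -PB -GF GFG.
Qed.

(** * Endomorphisms that are self-adjoint or skew-adjoint *)

(* The sign e records whether F is self-adjoint (e = 1) or skew (e = -1). *)
Section EpsAdjoint.
Variables (e : R) (F : 'End(V)).
Hypotheses (ee : e * e = 1) (aF : is_adjoint g F (e *: F)).

Lemma eps_adjointE u v : g (F u) v = e * g u (F v).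
Proof. by rewrite aF scale_lfunE dotZr. Qed.

(** [Im F] is orthogonal to [Ker F], so it meets it only in zero. *)
Lemma eps_adjoint_regular u : F (F u) = 0 -> F u = 0.
Proof. by move=> FF0; apply: dot_eq0; rewrite eps_adjointE FF0 linear0r mulr0. Qed.

Lemma eps_adjoint_sandwich A : orth_lie g A -> orth_lie g (F \o A \o F)%VF.
Proof.
move=> /orth_lieP oA; apply/orth_lieP => u v.
by rewrite !comp_lfunE eps_adjointE oA eps_adjointE mulrN mulrA ee mul1r.
Qed.

(** The conclusion is the adjoint of the hypothesis: the signs coming from [A]
    and [B] agree, and [F] contributes the factor [e] on both sides. *)
Lemma intertwine_adjoint A B : orth_lie g A -> orth_lie g B ->
  (A \o F = F \o B)%VF -> (F \o A = B \o F)%VF.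
Proof.
move=> /orth_lieP oA /orth_lieP oB /comp_eqP AF; apply/comp_eqP => u.
apply: dot_inj => w.
by rewrite eps_adjointE oA oB eps_adjointE AF mulrN.
Qed.

(** The projection [F \o G] is self-adjoint because [Ker F] and [Im F] are
    orthogonal; hence [G] has the same symmetry as [F]. *)
Lemma group_inverse_eps_adjoint G : group_inverse F G -> is_adjoint g G (e *: G).
Proof.
move=> [GF FGF GFG] u v; rewrite scale_lfunE dotZr.
have projE x y : g (F (G x)) y = g x (F (G y)).
  have idem x' y' : g (F (G x')) y' = g (F (G x')) (F (G y')).
    by rewrite !eps_adjointE -GF FGF.
  by rewrite idem [LHS]dotC -idem dotC.
have PG x : F (G (G x)) = G x by rewrite -GF GFG.
by rewrite -[in LHS]PG projE dotC eps_adjointE dotC projE PG.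
Qed.
End EpsAdjoint.

(** The heart of the matter: sandwiching by [F] fills the whole space of skew
    endomorphisms that live on [Im F]. A preimage of [X] is [G \o X \o G] with
    [G] the group inverse of [F], since [F \o G] and [G \o F] project on
    [Im F], where [X] lives; the intertwining condition follows [X] through [G].
    Taking [c], [d], [c'] and [d'] to be zero removes that condition. *)
Lemma sandwich_image (e : R) (F c d c' d' : 'End(V)) :
  orth_lie g c -> orth_lie g d -> orth_lie g c' -> orth_lie g d' ->
  e * e = 1 -> is_adjoint g F (e *: F) ->
  (c \o F = F \o c')%VF -> (F \o d = d' \o F)%VF ->
  (fun A => F \o A \o F)%VF @` [set A | orth_lie g A /\ (c' \o A = A \o d')%VF]
  = [set X | [/\ orth_lie g X, (c \o X = X \o d)%VF & ker_im_compat F X]].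
Proof.
move=> oc od oc' od' ee aF cF Fd; apply/seteqP; split=> [_ [A [oA cA] <-]|X [oX cX]].
  have dF := esym (intertwine_adjoint aF od' od (esym Fd)).
  move/comp_eqP: cF => cF; move/comp_eqP: dF => dF; move/comp_eqP: cA => cA.
  move/comp_eqP: Fd => Fd.
  split; first exact: (eps_adjoint_sandwich ee aF).
    by apply/comp_eqP => u; rewrite !comp_lfunE cF cA Fd.
  apply/ker_im_compatP; split=> v; first by rewrite !comp_lfunE => ->; rewrite !linear0.
  by exists (A (F (F v))); rewrite !comp_lfunE.
move=> /ker_im_compatP[kX iX].
have [G GI] := group_inverse_exists (eps_adjoint_regular aF).
have [GF FGF _] := GI.
have aG := group_inverse_eps_adjoint aF GI.
have /comp_eqP Gc := group_inverse_intertwine GI cF (intertwine_adjoint aF oc oc' cF).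
have dF := intertwine_adjoint aF od' od (esym Fd).
have /comp_eqP Gd := group_inverse_intertwine GI (esym Fd) dF.
exists (G \o X \o G)%VF; first split.
- exact: (eps_adjoint_sandwich ee aG oX).
- move/comp_eqP: cX => cX.
  by apply/comp_eqP => u; rewrite !comp_lfunE -Gc cX -Gd.
- have XP u : X (F (G u)) = X u.
    apply/eqP; rewrite -subr_eq0 -linearB; apply/eqP/kX.
    by rewrite linearB /= -GF FGF subrr.
  apply/lfunP => u; rewrite !comp_lfunE GF XP.
  by have [w e1] := iX (G u); rewrite -[X u]XP e1 FGF.
Qed.

(** * The commutator with the tautological section *)

Lemma commutatorE A B u : commutator A B u = A (B u) - B (A u).
Proof. by rewrite /commutator add_lfunE opp_lfunE !comp_lfunE. Qed.

Lemma commutator_o_anti K X :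
  twistor g K -> orth_lie g X -> fiber g (o_anti V) K (commutator X K).
Proof.
move=> /twistorP[KK /[swap] /orth_lieP oX oK]; split.
  apply/orth_lieP => u v.
  by rewrite !commutatorE dotBl dotBr oX oK oK oX !opprK opprB.
apply/comp_eqP => u; rewrite opp_lfunE !commutatorE /phi !linearB !linearN /=.
rewrite !KK !linearN /= !opprK; exact: addrC.
Qed.

(** The relations on [K] say that [K] preserves [Ker F] and [Im F]. *)
Lemma commutator_compat F K X (c' : 'End(V)) :
  (K \o F = F \o c')%VF -> (F \o K = c' \o F)%VF ->
  ker_im_compat F X -> ker_im_compat F (commutator X K).
Proof.
move=> /comp_eqP KF /comp_eqP FK /ker_im_compatP[kX iX].
apply/ker_im_compatP; split=> v.
  move=> Fv0; rewrite commutatorE (kX _ Fv0) linear0 subr0.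
  by apply: kX; rewrite FK Fv0 linear0.
have [w Xv] := iX v; have [w' Xv'] := iX (c' v).
by exists (w' - c' w); rewrite commutatorE KF Xv Xv' KF linearB.
Qed.

(** On endomorphisms anticommuting with [K], the commutator with [K] is
    [X |-> 2 X K], whose square is [- 4]. So it maps [D] onto [D], and any [T]
    between [D] and the space of all compatible skew endomorphisms has the same
    image. *)
Lemma commutator_image (F K c' : 'End(V)) (T : set 'End(V)) :
  twistor g K -> (K \o F = F \o c')%VF -> (F \o K = c' \o F)%VF ->
  let D := [set B | fiber g (o_anti V) K B /\ ker_im_compat F B] in
  D `<=` T -> T `<=` [set X | orth_lie g X /\ ker_im_compat F X] ->
  (fun X => commutator X K) @` T = D.
Proof.
move=> TK KF FK D DT TD; apply/seteqP; split=> [_ [X /TD[oX cX] <-]|B].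
  by split; [exact: commutator_o_anti | exact: (commutator_compat KF FK cX)].
move=> [[oB /comp_eqP KB] cB]; have [KK _] := twistorP TK.
have {}KB u : K (B u) = - B (K u) by rewrite -linearN -opp_lfunE KB.
have oB' : orth_lie g (- 4^-1 *: B).
  apply/orth_lieP => u v; move/orth_lieP: oB => oB.
  by rewrite !scale_lfunE dotZr dotC dotZr -dotC oB mulrN.
have cB' : ker_im_compat F (- 4^-1 *: B).
  move/ker_im_compatP: cB => [kB iB]; apply/ker_im_compatP; split=> v.
    by move=> /kB; rewrite scale_lfunE => ->; rewrite scaler0.
  by have [w Bv] := iB v; exists (- 4^-1 *: w); rewrite scale_lfunE Bv linearZ.
(* Taking the commutator with K twice multiplies B by - 4. *)
exists (commutator (- 4^-1 *: B) K).
  by apply: DT; split; [exact: commutator_o_anti | exact: (commutator_compat KF FK cB')].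
apply/lfunP => u; rewrite !commutatorE !scale_lfunE.
have KZ a x : K (a *: x) = a *: K x by exact: linearZ.
rewrite [K (_ - _)]linearB /= !KZ [K (K (B u))]KK !KB KK [B (- u)]linearN /=.
rewrite !scaleNr !scalerN opprD !opprK -!scalerDl.
by rewrite -[RHS]scale1r; congr (_ *: _); field.
Qed.
End PointwiseTheory.

(** * The action of the admissible sections on the signed units *)

Section AdmissibleSections.
Variables (R : realType) (V : vectType R) (g : {dot V for @idfun R}).
Variables (J : 'End(V)) (TJ : twistor g J).
Implicit Types (S : section V) (K Q : 'End(V)).

(** Since [J] and [K] square to [- 1], [1] fixes [J] and [K], [J + K] exchanges
    them, [J - K] exchanges them up to sign, and their commutator changes
    the sign of both. *)
Lemma admissible_swap S : admissible_S J S ->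
  exists j p : section V, [/\ signed_units J j, signed_units J p &
    forall K, twistor g K ->
      [/\ (J \o S K = S K \o j K)%VF, (S K \o J = j K \o S K)%VF,
          (K \o S K = S K \o p K)%VF & (S K \o K = p K \o S K)%VF]].
Proof.
have [JJ _] := twistorP TJ.
move=> [[[|]|]|] ->.
- exists (cst J), (@phi R V); split; [by left; left; left|by left; right|].
  by move=> K _; split; rewrite ?comp_lfun1l ?comp_lfun1r.
- exists (@phi R V), (cst J); split; [by left; right|by left; left; left|].
  move=> K /twistorP[KK _]; split; apply/comp_eqP => u;
  by rewrite !add_lfunE /phi linearD /= JJ KK // addrC.
- exists (fun K => - phi K), (cst (- J)); split; [by right|by left; left; right|].
  move=> K /twistorP[KK _]; split; apply/comp_eqP => u;
  rewrite /phi !(add_lfunE, opp_lfunE) !(linearB, linearN) /= ?opprB JJ KK;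
  by rewrite !opprK addrC.
- exists (cst (- J)), (fun K => - phi K); split;
    [by left; left; right|by right|].
  move=> K /twistorP[KK _]; split; apply/comp_eqP => u;
  rewrite /phi !(opp_lfunE, commutatorE) !(linearB, linearN) /= ?opprB ?JJ ?KK;
  by rewrite !opprK ?linearN /= ?opprK addrC.
Qed.

Lemma signed_unitsN (gamma : section V) :
  signed_units J gamma -> signed_units J (fun K => - gamma K).
Proof.
move=> [[[|]|]|] ->.
- by left; left; right.
- by left; left; left; apply/funext => K; rewrite opprK.
- by right.
- by left; right; apply/funext => K; rewrite opprK.
Qed.

Lemma tilde_exists S (gamma : section V) :
  admissible_S J S -> signed_units J gamma ->
  exists gamma', signed_units J gamma' /\ forall K, twistor g K ->
    (gamma K \o S K = S K \o gamma' K)%VF /\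
    (S K \o gamma K = gamma' K \o S K)%VF.
Proof.
move=> /admissible_swap[j [p [sj sp jp]]] [[[|]|]|] ->.
- by exists j; split=> // K /jp[].
- exists (fun K => - j K); split=> [|K /jp[jS Sj _ _]].
    exact: signed_unitsN.
  by rewrite /= !(comp_lfunNl, comp_lfunNr) jS Sj.
- by exists p; split=> // K /jp[].
- exists (fun K => - p K); split=> [|K /jp[_ _ pS Sp]].
    exact: signed_unitsN.
  by rewrite /= !(comp_lfunNl, comp_lfunNr) pS Sp.
Qed.

(** By [tilde_exists] the choice operator in [tilde_l] picks an actual solution
    of the defining relation. *)
Lemma tilde_lP S (gamma : section V) :
  admissible_S J S -> signed_units J gamma ->
  signed_units J (tilde_l g J S gamma) /\ forall K, twistor g K ->
    (gamma K \o S K = S K \o tilde_l g J S gamma K)%VF.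
Proof.
move=> aS sgamma; have [c [sc cS]] := tilde_exists aS sgamma.
apply: (@xgetPex _ _ [set c' | signed_units J c' /\
  forall K, twistor g K -> (gamma K \o S K = S K \o c' K)%VF]).
by exists c; split=> // K /cS[].
Qed.

Lemma tilde_rP S (delta : section V) :
  admissible_S J S -> signed_units J delta ->
  signed_units J (tilde_r g J S delta) /\ forall K, twistor g K ->
    (S K \o delta K = tilde_r g J S delta K \o S K)%VF.
Proof.
move=> aS sdelta; have [d [sd dS]] := tilde_exists aS sdelta.
apply: (@xgetPex _ _ [set d' | signed_units J d' /\
  forall K, twistor g K -> (S K \o delta K = d' K \o S K)%VF]).
by exists d; split=> // K /dS[].
Qed.

Lemma signed_units_orth_lie (gamma : section V) K :
  signed_units J gamma -> twistor g K -> orth_lie g (gamma K).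
Proof.
move=> sg /twistor_orth_lie oK; have oJ := twistor_orth_lie TJ.
have oN A : orth_lie g A -> orth_lie g (- A).
  move=> /orth_lieP oA; apply/orth_lieP => u v.
  by rewrite !opp_lfunE dotNl dotNr oA.
by case: sg => [[[|]|]|] -> //; exact: oN.
Qed.

Lemma signed_units_comm Q K (gamma : section V) : signed_units J gamma ->
  commutator Q J = 0 -> commutator Q K = 0 ->
  (Q \o gamma K = gamma K \o Q)%VF.
Proof.
move=> sg /eqP; rewrite subr_eq0 => /eqP QJ /eqP; rewrite subr_eq0 => /eqP QK.
by case: sg => [[[|]|]|] -> //=; rewrite comp_lfunNl comp_lfunNr ?QJ ?QK.
Qed.

Lemma admissible_comm Q S K : admissible_S J S ->
  commutator Q J = 0 -> commutator Q K = 0 -> forall u, Q (S K u) = S K (Q u).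
Proof.
move=> aS /commutator_eq0P QJ /commutator_eq0P QK u.
case: aS => [[[|]|]|] ->; rewrite /phi ?commutatorE ?(id_lfunE, add_lfunE, opp_lfunE);
  by rewrite ?(linearD, linearB) /= ?linearN /= ?QJ ?QK ?QJ ?QK.
Qed.

Lemma admissible_eps_adjoint S K : admissible_S J S -> twistor g K ->
  exists2 e : R, e * e = 1 & is_adjoint g (S K) (e *: S K).
Proof.
move=> aS TK; have [_ oJ] := twistorP TJ; have [_ oK] := twistorP TK.
case: aS => [[[|]|]|] ->; [exists 1|exists (-1)|exists (-1)|exists (-1)];
  rewrite ?mulr1 ?mulrNN ?mulr1 //.
  by move=> u v; rewrite scale1r /= !id_lfunE.
all: rewrite scaleN1r; apply/orth_lieP => u v.
all: rewrite /phi ?commutatorE ?(add_lfunE, opp_lfunE).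
- by rewrite dotDl dotDr oJ oK opprD.
- by rewrite dotBl dotBr oJ oK opprB opprK addrC.
- by rewrite dotBl dotBr oJ oK oK oJ !opprK opprB.
Qed.
End AdmissibleSections.

(** * The images of psi *)

Theorem theorem5p3 (R : realType) (V : vectType R) (g : {dot V for @idfun R})
  (n : nat) (dimV : \dim {:V} = (2 * n)%N) (dimV_ge4 : (4 <= \dim {:V})%N)
  (J : 'End(V)) (TJ : twistor g J)
  (Q S : section V)
  (Q_smooth : smooth_section g Q)
  (Q_selfadjoint : forall K, twistor g K -> is_adjoint g (Q K) (Q K))
  (Q_J : forall K, twistor g K -> commutator (Q K) J = 0)
  (Q_phi : forall K, twistor g K -> commutator (Q K) (phi K) = 0)
  (S_adm : admissible_S J S) :
  let F : section V := fun K => (Q K \o S K)%VF in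
  forall K, twistor g K ->
  [/\ forall E, E = FullO V \/ E = o_anti V ->
        psi F K @` fiber g (twist g J E S) K = distrib g F K,
      psi F K @` fiber g (twist g J (u_of (cst J)) S) K = distrib_uJ g J F K
    & psi F K @` fiber g (twist g J (u_of (@phi R V)) S) K = [set 0]].
Proof.
move=> F K TK.
have cQJ := Q_J K TK; have cQK := Q_phi K TK; rewrite /phi in cQK.
have [e ee aS] := admissible_eps_adjoint TJ S_adm TK.
have aF : is_adjoint g (F K) (e *: F K).
  move=> u v; have aQ := Q_selfadjoint K TK.
  rewrite /F scale_lfunE !comp_lfunE aQ aS scale_lfunE.
  by rewrite (admissible_comm S_adm cQJ cQK).
have left_F gamma : signed_units J gamma ->
    (gamma K \o F K = F K \o tilde_l g J S gamma K)%VF.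
  move=> sg; have [_ /(_ K TK) gS] := tilde_lP TJ S_adm sg.
  by rewrite /F comp_lfunA -(signed_units_comm sg cQJ cQK) -comp_lfunA gS comp_lfunA.
have right_F delta : signed_units J delta ->
    (F K \o delta K = tilde_r g J S delta K \o F K)%VF.
  move=> sd; have [sd' /(_ K TK) Sd] := tilde_rP TJ S_adm sd.
  by rewrite /F -comp_lfunA Sd comp_lfunA (signed_units_comm sd' cQJ cQK) comp_lfunA.
have sandwich gamma delta : signed_units J gamma -> signed_units J delta ->
    (fun A => F K \o A \o F K)%VF @`
      fiber g (twist g J (Intertwiner gamma delta) S) K =
    [set X | [/\ orth_lie g X, (gamma K \o X = X \o delta K)%VF
               & ker_im_compat (F K) X]].
  move=> sg sd; apply: sandwich_image ee aF (left_F _ sg) (right_F _ sd);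
    apply: (signed_units_orth_lie TJ) => //.
    by case: (tilde_lP TJ S_adm sg).
  by case: (tilde_rP TJ S_adm sd).
have psiE T : psi F K @` T =
    (fun X => commutator X K) @` ((fun A => F K \o A \o F K)%VF @` T).
  by rewrite image_comp.
have sJ : signed_units J (cst J) by left; left; left.
have sphi : signed_units J (@phi R V) by left; right.
have sNphi : signed_units J (fun K => - phi K) by right.
(* K preserves Ker F and Im F, as commutator_image requires. *)
have KF := left_F _ sphi.
have FK : (F K \o K = tilde_l g J S (@phi R V) K \o F K)%VF.
  apply: (intertwine_adjoint aF) KF; first exact: twistor_orth_lie.
  by apply: (signed_units_orth_lie TJ) => //; case: (tilde_lP TJ S_adm sphi).
split.
- move=> E [->|->]; rewrite psiE; last first.
    rewrite sandwich //; apply: (commutator_image TK KF FK).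
      by move=> B [[oB KB] cB].
    by move=> X [oX _ cX].
  have o0 := orth_lie0 g.
  (* The full bundle is the intertwiner of the zero endomorphisms. *)
  have full : orth_lie g = [set A | orth_lie g A /\ (0 \o A = A \o 0)%VF].
    by apply/seteqP; split=> [A oA|A []] //; split=> //; rewrite comp_lfun0l comp_lfun0r.
  rewrite /= full (sandwich_image o0 o0 o0 o0 ee aF) ?comp_lfun0l ?comp_lfun0r //.
  apply: (commutator_image TK KF FK).
    by move=> B [[oB KB] cB]; split=> //; rewrite comp_lfun0l comp_lfun0r.
  by move=> X [oX _ cX].
- rewrite psiE sandwich //; apply/seteqP; split=> [_ [X [oX JX cX] <-]|C].
    by split; [exact: commutator_o_anti | exists X].
  by move=> [_ [B [[oB JB] cB ->]]]; exists B.
- rewrite psiE sandwich //; apply/seteqP; split=> [_ [X [oX KX cX] <-]|_ ->].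
    by rewrite /commutator /= KX subrr.
  exists 0; last by rewrite /commutator comp_lfun0l comp_lfun0r subrr.
  split; first exact: orth_lie0.
    by rewrite comp_lfun0l comp_lfun0r.
  apply/ker_im_compatP; split=> v; first by rewrite zero_lfunE.
  by exists 0; rewrite zero_lfunE linear0.
Qed.
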